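(* For a tensor-representable monoidal category $\mathcal{C}$ the following are equivalent: (i) the right dualising functor $R\colon\mathcal{C}^{\mathrm{op}}\to\mathcal{C}$ of $\mathcal{C}$ admits a quasi-inverse; (ii) $\mathcal{C}$ is an $r$-category; (iii) there is an object $d\in\mathcal{C}$ such that $(\mathcal{C},d)$ is a right Grothendieck--Verdier category.
   Context: A monoidal category $\mathcal{C}$ is right tensor-representable if for every $x\in\mathcal{C}$ there is an object $Rx$ such that $Rx\otimes-$ is right adjoint to $x\otimes-$; it is left tensor-representable if for every $x$ there is an object $Lx$ such that $-\otimes Lx$ is right adjoint to $-\otimes x$; it is tensor-representable if it is both. Such a category is right closed with $[x,y]_r\cong Rx\otimes y$ right adjoint to $x\otimes -$, and its right (tensor-)dualising functor is $R=[-,1]_r\colon\mathcal{C}^{\mathrm{op}}\to\mathcal{C}$. A right Grothendieck--Verdier category is a pair $(\mathcal{C},d)$ of a monoidal category and an object $d$ such that for every $x\in\mathcal{C}$ there is an object $D_rx$ with $\mathcal{C}(x\otimes-,d)\cong\mathcal{C}(-,D_rx)$, and the induced functor $D_r\colon\mathcal{C}^{\mathrm{op}}\to\mathcal{C}$ is an equivalence of categories. It is an $r$-category if $d=1$ is the monoidal unit. *)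

(* Defs.v *)
From mathcomp Require Import ssreflect ssrfun.

Set Implicit Arguments.
Unset Strict Implicit.
Unset Printing Implicit Defensive.

Declare Scope cat_scope.
Delimit Scope cat_scope with cat.
Local Open Scope cat_scope.

Record Category := {
  Ob :> Type;
  Hom : Ob -> Ob -> Type;
  idm : forall x, Hom x x;
  compm : forall x y z, Hom y z -> Hom x y -> Hom x z;
  compm1 : forall x y (f : Hom x y), compm f (idm x) = f;
  comp1m : forall x y (f : Hom x y), compm (idm y) f = f;
  compmA : forall w x y z (h : Hom y z) (g : Hom x y) (f : Hom w x),
    compm h (compm g f) = compm (compm h g) f }.

Arguments Hom {c} x y.
Arguments idm {c} x.
Arguments compm {c x y z} g f : rename.

Notation "x ~> y" := (Hom x y)
  (at level 90, y at level 200, no associativity) : cat_scope.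
Notation "g ∘ f" := (compm g f) (at level 40, left associativity) : cat_scope.

Definition op (C : Category) : Category := {|
  Ob := C;
  Hom := fun x y => @Hom C y x;
  idm := fun x => @idm C x;
  compm := fun x y z g f => @compm C z y x f g;
  compm1 := fun x y f => comp1m f;
  comp1m := fun x y f => compm1 f;
  compmA := fun w x y z h g f => esym (compmA f g h) |}.

Record Iso (C : Category) (x y : C) := {
  iso_hom : x ~> y;
  iso_inv : y ~> x;
  iso_invK : iso_inv ∘ iso_hom = idm x;
  iso_homK : iso_hom ∘ iso_inv = idm y }.

Record Functor (C D : Category) := {
  fob :> C -> D;
  fmap : forall x y, (x ~> y) -> (fob x ~> fob y);
  fmap1 : forall x, fmap (idm x) = idm (fob x);
  fmapM : forall x y z (g : y ~> z) (f : x ~> y),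
    fmap (g ∘ f) = fmap g ∘ fmap f }.

Arguments fmap {C D} F {x y} f : rename.

Definition idF (C : Category) : Functor C C := {|
  fob := fun x => x;
  fmap := fun x y f => f;
  fmap1 := fun x => erefl;
  fmapM := fun x y z g f => erefl |}.

Program Definition compF (C D E : Category) (G : Functor D E) (F : Functor C D) :
  Functor C E := {|
  fob := fun x => G (F x);
  fmap := fun x y f => fmap G (fmap F f) |}.
Next Obligation. by move=> * /=; rewrite !fmap1. Qed.
Next Obligation. by move=> * /=; rewrite !fmapM. Qed.

Record NatIso (C D : Category) (F G : Functor C D) := {
  nat_iso :> forall x, Iso (F x) (G x);
  nat_isoN : forall x y (f : x ~> y),
    iso_hom (nat_iso y) ∘ fmap F f = fmap G f ∘ iso_hom (nat_iso x) }.

Definition quasi_inverse (C D : Category) (F : Functor C D) (G : Functor D C) :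
  Prop :=
  inhabited (NatIso (compF G F) (idF C)) /\ inhabited (NatIso (compF F G) (idF D)).

Definition is_equivalence (C D : Category) (F : Functor C D) : Prop :=
  exists G : Functor D C, quasi_inverse F G.

(* [Adjunction F G]: F is left adjoint to G. *)
Record Adjunction (C D : Category) (F : Functor C D) (G : Functor D C) := {
  adj_to : forall x y, (F x ~> y) -> (x ~> G y);
  adj_from : forall x y, (x ~> G y) -> (F x ~> y);
  adj_toK : forall x y, cancel (@adj_to x y) (@adj_from x y);
  adj_fromK : forall x y, cancel (@adj_from x y) (@adj_to x y);
  adj_toN : forall x x' y y' (h : x' ~> x) (k : y ~> y') (f : F x ~> y),
    adj_to (k ∘ f ∘ fmap F h) = fmap G k ∘ adj_to f ∘ h }.

(* A representation of the presheaf D(F -, d): an object r together with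
   bijections D(F y, d) = C(y, r), natural in y. *)
Record Representation (C D : Category) (F : Functor C D) (d : D) := {
  rep_ob : C;
  rep_to : forall y, (F y ~> d) -> (y ~> rep_ob);
  rep_from : forall y, (y ~> rep_ob) -> (F y ~> d);
  rep_toK : forall y, cancel (@rep_to y) (@rep_from y);
  rep_fromK : forall y, cancel (@rep_from y) (@rep_to y);
  rep_toN : forall y y' (h : y' ~> y) (f : F y ~> d),
    rep_to (f ∘ fmap F h) = rep_to f ∘ h }.

Arguments rep_to {C D F d} r {y} f : rename.
Arguments rep_from {C D F d} r {y} f : rename.
Arguments rep_toK {C D F d} r {y} : rename.
Arguments rep_fromK {C D F d} r {y} : rename.

Program Definition adj_representation (C D : Category) (F : Functor C D)
  (G : Functor D C) (A : Adjunction F G) (d : D) : Representation F d := {|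
  rep_ob := G d;
  rep_to := fun y => @adj_to _ _ _ _ A y d;
  rep_from := fun y => @adj_from _ _ _ _ A y d |}.
Next Obligation. by move=> *; exact: adj_toK. Qed.
Next Obligation. by move=> *; exact: adj_fromK. Qed.
Next Obligation.
by move=> C D F G A d y y' h f; rewrite -{1}[f]comp1m adj_toN fmap1 comp1m.
Qed.

Reserved Notation "x ⊗ y" (at level 39, left associativity).
Reserved Notation "f ⊗₁ g" (at level 39, left associativity).

Record MonoidalCategory := {
  mcat :> Category;
  unit_ob : mcat;
  tensor : mcat -> mcat -> mcat
    where "x ⊗ y" := (tensor x y);
  tensorm : forall x x' y y' : mcat,
      (x ~> x') -> (y ~> y') -> (x ⊗ y ~> x' ⊗ y')
    where "f ⊗₁ g" := (tensorm f g);
  tensorm1 : forall x y : mcat, idm x ⊗₁ idm y = idm (x ⊗ y);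
  tensormM : forall (x x' x'' y y' y'' : mcat)
      (f' : x' ~> x'') (f : x ~> x') (g' : y' ~> y'') (g : y ~> y'),
    (f' ∘ f) ⊗₁ (g' ∘ g) = (f' ⊗₁ g') ∘ (f ⊗₁ g);
  assoc : forall x y z : mcat, Iso (x ⊗ y ⊗ z) (x ⊗ (y ⊗ z));
  lunit : forall x : mcat, Iso (unit_ob ⊗ x) x;
  runit : forall x : mcat, Iso (x ⊗ unit_ob) x;
  assocN : forall (x x' y y' z z' : mcat)
      (f : x ~> x') (g : y ~> y') (h : z ~> z'),
    iso_hom (assoc x' y' z') ∘ (f ⊗₁ g ⊗₁ h) =
    (f ⊗₁ (g ⊗₁ h)) ∘ iso_hom (assoc x y z);
  lunitN : forall (x x' : mcat) (f : x ~> x'),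
    iso_hom (lunit x') ∘ (idm unit_ob ⊗₁ f) = f ∘ iso_hom (lunit x);
  runitN : forall (x x' : mcat) (f : x ~> x'),
    iso_hom (runit x') ∘ (f ⊗₁ idm unit_ob) = f ∘ iso_hom (runit x);
  triangle : forall x y : mcat,
    (idm x ⊗₁ iso_hom (lunit y)) ∘ iso_hom (assoc x unit_ob y) =
    iso_hom (runit x) ⊗₁ idm y;
  pentagon : forall w x y z : mcat,
    iso_hom (assoc w x (y ⊗ z)) ∘ iso_hom (assoc (w ⊗ x) y z) =
    (idm w ⊗₁ iso_hom (assoc x y z)) ∘ iso_hom (assoc w (x ⊗ y) z) ∘
      (iso_hom (assoc w x y) ⊗₁ idm z) }.

Arguments unit_ob C : rename.
Arguments tensor {C} x y : rename.
Arguments tensorm {C x x' y y'} f g : rename.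

Notation "x ⊗ y" := (tensor x y) : cat_scope.
Notation "f ⊗₁ g" := (tensorm f g) : cat_scope.

(* The functor x ⊗ - . *)
Program Definition ltensor (C : MonoidalCategory) (x : C) : Functor C C := {|
  fob := fun y => x ⊗ y;
  fmap := fun y y' g => idm x ⊗₁ g |}.
Next Obligation. by move=> *; exact: tensorm1. Qed.
Next Obligation. by move=> * /=; rewrite -tensormM comp1m. Qed.

(* The functor - ⊗ x . *)
Program Definition rtensor (C : MonoidalCategory) (x : C) : Functor C C := {|
  fob := fun y => y ⊗ x;
  fmap := fun y y' g => g ⊗₁ idm x |}.
Next Obligation. by move=> *; exact: tensorm1. Qed.
Next Obligation. by move=> * /=; rewrite -tensormM comp1m. Qed.

(* The objects and adjunctions asserted to exist are recorded as chosen data;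
   a theorem quantified over this record holds for every choice of them. The
   adjunctions are adjunctions of plain functors. *)
Record TensorRepresentable (C : MonoidalCategory) := {
  Rob : C -> C;
  Rob_adj : forall x, Adjunction (ltensor x) (ltensor (Rob x));
  Lob : C -> C;
  Lob_adj : forall x, Adjunction (rtensor x) (rtensor (Lob x)) }.

Record RightClosed (C : MonoidalCategory) := {
  rhom : C -> Functor C C;
  rhom_adj : forall x, Adjunction (ltensor x) (rhom x) }.

(* The internal hom is [x, y]_r := R x ⊗ y. *)
Definition tensor_right_closed (C : MonoidalCategory)
  (T : TensorRepresentable C) : RightClosed C := {|
  rhom := fun x => ltensor (Rob T x);
  rhom_adj := Rob_adj T |}.

Definition ind_map (C : MonoidalCategory) (d : C)
  (r : forall x : C, Representation (ltensor x) d) (x x' : C) (f : x ~> x') :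
  rep_ob (r x') ~> rep_ob (r x) :=
  rep_to (r x) (rep_from (r x') (idm _) ∘ (f ⊗₁ idm _)).

(* [ind_map] is the action making the bijections C(x ⊗ y, d) = C(y, r x)
   natural in x. *)
Lemma ind_mapN (C : MonoidalCategory) (d : C)
  (r : forall x : C, Representation (ltensor x) d) (x x' y : C)
  (f : x ~> x') (g : x' ⊗ y ~> d) :
  rep_to (r x) (g ∘ (f ⊗₁ idm y)) = ind_map r f ∘ rep_to (r x') g.
Proof.
rewrite /ind_map -rep_toN /=; congr rep_to.
rewrite -compmA -tensormM compm1 comp1m.
rewrite -[in LHS](rep_toK (r x') g).
have fromN z z' (h : z' ~> z) (k : z ~> rep_ob (r x')) :
    rep_from (r x') (k ∘ h) = rep_from (r x') k ∘ (idm x' ⊗₁ h).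
  by rewrite -{1}(rep_fromK (r x') k) -rep_toN rep_toK.
rewrite -{1}[rep_to (r x') g]comp1m fromN -compmA -tensormM.
by rewrite comp1m compm1.
Qed.

Program Definition induced_functor (C : MonoidalCategory) (d : C)
  (r : forall x : C, Representation (ltensor x) d) : Functor (op C) C := {|
  fob := fun x : op C => rep_ob (r x);
  fmap := fun x' x f => ind_map r f |}.
Next Obligation. by move=> C d r x; rewrite /ind_map tensorm1 compm1 rep_fromK. Qed.
Next Obligation.
move=> C d r x y z /= g f; rewrite {2}/ind_map -ind_mapN -compmA -tensormM compm1.
by rewrite /ind_map.
Qed.

(* R = [-, 1]_r *)
Definition right_dualising (C : MonoidalCategory) (H : RightClosed C) :
  Functor (op C) C :=
  induced_functor (fun x => adj_representation (rhom_adj H x) (unit_ob C)).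

Definition right_GV (C : MonoidalCategory) (d : C) : Prop :=
  exists D : forall x : C, Representation (ltensor x) d,
    is_equivalence (induced_functor D).

Definition r_category (C : MonoidalCategory) : Prop := right_GV (unit_ob C).

(* Main.v *)
From mathcomp Require Import ssreflect ssrfun.
Require Import Defs.

(** The equivalence of (i) and (ii) says that the dualising functor determined
    by an object [d] does not depend, up to natural isomorphism, on the chosen
    representing objects: by the Yoneda lemma any two functors [K] with
    C(x ⊗ y, d) ≅ C(y, K x), naturally in [x] and [y], are isomorphic
    ([dualisation_unique]), and being an equivalence is invariant under natural
    isomorphism.

    For (iii) implies (ii), the point is that a dualising object [d] is
    invertible for the tensor product, thanks to tensor-representability on both
    sides. Let [K] be the dualising functor of [d], an equivalence with
    quasi-inverse [E].
    - With e = E 1, the presheaf C(e ⊗ -, d) is represented by K e ≅ 1 and, by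
      right tensor-representability, by R e ⊗ d. Hence R e ⊗ d ≅ 1.
    - With k = K 1, the presheaf C(- ⊗ k, d) ≅ C(k, K -) ≅ C(-, 1) is represented
      by 1 and, by left tensor-representability, by d ⊗ L k. Hence d ⊗ L k ≅ 1.
    An object with a left and a right inverse is invertible, so with b = L k the
    functors - ⊗ d and - ⊗ b are mutually quasi-inverse, and
      C(x ⊗ y, 1) ≅ C((x ⊗ y) ⊗ d, d) ≅ C(y ⊗ d, K x) ≅ C(y, K x ⊗ b).
    The dualising functor of the unit is therefore the composite of the
    equivalences [K] and - ⊗ b.

    The isomorphisms K x ≅ R x ⊗ d alone would not suffice: the adjunctions
    x ⊗ - ⊣ R x ⊗ - are adjunctions of plain functors, so the map
    R x' ⊗ d -> R x ⊗ d induced by f : x -> x' need not be R f ⊗ d. The natural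
    comparison of [K] with the dualising functor of the unit comes from the
    invertibility of [d] ([untwist]). *)

Set Implicit Arguments.
Unset Strict Implicit.
Unset Printing Implicit Defensive.

Local Open Scope cat_scope.

(** * Isomorphisms and natural isomorphisms *)

Lemma iso_invKl (C : Category) (x y z : C) (u : Iso x y) (f : z ~> x) :
  iso_inv u ∘ (iso_hom u ∘ f) = f.
Proof. by rewrite compmA iso_invK comp1m. Qed.

Lemma iso_homKl (C : Category) (x y z : C) (u : Iso x y) (f : z ~> y) :
  iso_hom u ∘ (iso_inv u ∘ f) = f.
Proof. by rewrite compmA iso_homK comp1m. Qed.

Definition iso_sym (C : Category) (x y : C) (u : Iso x y) : Iso y x :=
  {| iso_invK := iso_homK u; iso_homK := iso_invK u |}.

Program Definition iso_trans (C : Category) (x y z : C)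
  (u : Iso x y) (v : Iso y z) : Iso x z :=
  {| iso_hom := iso_hom v ∘ iso_hom u; iso_inv := iso_inv u ∘ iso_inv v |}.
Next Obligation. by move=> *; rewrite -compmA iso_invKl iso_invK. Qed.
Next Obligation. by move=> *; rewrite -compmA iso_homKl iso_homK. Qed.

Program Definition iso_map (C D : Category) (F : Functor C D) (x y : C)
  (u : Iso x y) : Iso (F x) (F y) :=
  {| iso_hom := fmap F (iso_hom u); iso_inv := fmap F (iso_inv u) |}.
Next Obligation. by move=> *; rewrite -fmapM iso_invK fmap1. Qed.
Next Obligation. by move=> *; rewrite -fmapM iso_homK fmap1. Qed.

Lemma nat_isoN_inv (C D : Category) (F G : Functor C D) (n : NatIso F G)
  (x y : C) (f : x ~> y) :
  iso_inv (n y) ∘ fmap G f = fmap F f ∘ iso_inv (n x).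
Proof.
rewrite -[LHS]compm1 -(iso_homK (n x)) compmA -(compmA _ (fmap G f)).
by rewrite -nat_isoN iso_invKl.
Qed.

Program Definition nat_iso_sym (C D : Category) (F G : Functor C D)
  (n : NatIso F G) : NatIso G F :=
  {| nat_iso := fun x => iso_sym (n x) |}.
Next Obligation. by move=> * /=; rewrite nat_isoN_inv. Qed.

Program Definition nat_iso_trans (C D : Category) (F G H : Functor C D)
  (n : NatIso F G) (m : NatIso G H) : NatIso F H :=
  {| nat_iso := fun x => iso_trans (n x) (m x) |}.
Next Obligation.
by move=> * /=; rewrite -compmA nat_isoN compmA nat_isoN compmA.
Qed.

Program Definition whisker_left (C D E : Category) (G : Functor D E)
  (F F' : Functor C D) (n : NatIso F F') : NatIso (compF G F) (compF G F') :=
  {| nat_iso := fun x => iso_map G (n x) |}.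
Next Obligation. by move=> * /=; rewrite -!fmapM nat_isoN. Qed.

Program Definition whisker_right (C D E : Category) (G G' : Functor D E)
  (F : Functor C D) (n : NatIso G G') : NatIso (compF G F) (compF G' F) :=
  {| nat_iso := fun x => n (F x) |}.
Next Obligation. by move=> * /=; rewrite nat_isoN. Qed.

(** Cancellation of an inner pair of functors, the form in which the unit of
    one equivalence enters the unit of a composite of two. *)
Program Definition cancel_inner (A B C D : Category) (P : Functor B A)
  (G : Functor C B) (H : Functor B C) (F : Functor D B)
  (n : NatIso (compF G H) (idF B)) :
  NatIso (compF (compF P G) (compF H F)) (compF P F) :=
  {| nat_iso := fun x => iso_map P (n (F x)) |}.
Next Obligation.
by move=> A B C D P G H F n x y f /=; rewrite -!fmapM -(nat_isoN n).
Qed.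

(** * Equivalences of categories *)

Lemma is_equivalence_iso (C D : Category) (F F' : Functor C D) :
  NatIso F F' -> is_equivalence F -> is_equivalence F'.
Proof.
move=> n [G [[h] [e]]]; exists G; split; constructor.
- exact: nat_iso_trans (whisker_left G (nat_iso_sym n)) h.
- exact: nat_iso_trans (whisker_right G (nat_iso_sym n)) e.
Qed.

Lemma is_equivalence_comp (C D E : Category) (G : Functor D E)
  (F : Functor C D) :
  is_equivalence G -> is_equivalence F -> is_equivalence (compF G F).
Proof.
move=> [G' [[hG] [eG]]] [F' [[hF] [eF]]]; exists (compF F' G').
split; constructor.
- exact: nat_iso_trans (cancel_inner F' F hG) hF.
- exact: nat_iso_trans (cancel_inner G G' eF) eG.
Qed.

(** An equivalence is fully faithful. The inverse of [fmap F] is given by a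
    formula, since it has to be used as a component of bijections on
    hom-types. *)
Section FullyFaithful.

Variables (C D : Category) (F : Functor C D) (G : Functor D C).
Variable eta : NatIso (compF G F) (idF C).

Definition unmap (x y : C) (g : F x ~> F y) : x ~> y :=
  iso_hom (eta y) ∘ fmap G g ∘ iso_inv (eta x).

Lemma fmapK (x y : C) : cancel (@fmap C D F x y) (@unmap x y).
Proof.
by move=> f; rewrite /unmap (nat_isoN eta) -compmA iso_homK compm1.
Qed.

End FullyFaithful.

(** Faithfulness of [G] reduces the claim to its image under [G], where it is
    the naturality of [eta]. *)
Lemma unmapK (C D : Category) (F : Functor C D) (G : Functor D C)
  (eta : NatIso (compF G F) (idF C)) (eps : NatIso (compF F G) (idF D))
  (x y : C) : cancel (@unmap C D F G eta x y) (@fmap C D F x y).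
Proof.
move=> g; apply: (can_inj (fmapK eps (x := F x) (y := F y))).
rewrite -[LHS](iso_invKl (eta y)) (nat_isoN eta) /= /unmap.
by rewrite -(compmA _ _ (iso_hom _)) iso_invK compm1 iso_invKl.
Qed.

Lemma unmapM (C D : Category) (F : Functor C D) (G : Functor D C)
  (eta : NatIso (compF G F) (idF C)) (x y z : C)
  (f : y ~> z) (g : F x ~> F y) :
  unmap eta (fmap F f ∘ g) = f ∘ unmap eta g.
Proof. by rewrite /unmap fmapM !compmA (nat_isoN eta). Qed.

Program Definition equivalence_adjunction (C D : Category) (F : Functor C D)
  (G : Functor D C) (eta : NatIso (compF G F) (idF C))
  (eps : NatIso (compF F G) (idF D)) : Adjunction F G :=
  {| adj_to := fun x y f => fmap G f ∘ iso_inv (eta x);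
     adj_from := fun x y g => unmap eps (g ∘ iso_hom (eta x)) |}.
Next Obligation.
by move=> C D F G eta eps x y f; rewrite -compmA iso_invK compm1 fmapK.
Qed.
Next Obligation.
by move=> C D F G eta eps x y g; rewrite (unmapK eps eta) -compmA iso_homK compm1.
Qed.
Next Obligation.
by move=> C D F G eta eps * /=; rewrite !fmapM -!compmA (nat_isoN_inv eta).
Qed.

(** * Representing objects and dualising functors *)

Section Representations.

Variables (C D : Category) (F : Functor C D) (d : D).

Lemma rep_fromN (r : Representation F d) (y y' : C) (h : y' ~> y)
  (k : y ~> rep_ob r) :
  rep_from r (k ∘ h) = rep_from r k ∘ fmap F h.
Proof. by rewrite -{1}(rep_fromK r k) -rep_toN rep_toK. Qed.

Program Definition rep_unique (r s : Representation F d) :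
  Iso (rep_ob r) (rep_ob s) :=
  {| iso_hom := rep_to s (rep_from r (idm _));
     iso_inv := rep_to r (rep_from s (idm _)) |}.
Next Obligation.
by move=> r s; rewrite -rep_toN -rep_fromN comp1m rep_toK rep_fromK.
Qed.
Next Obligation.
by move=> r s; rewrite -rep_toN -rep_fromN comp1m rep_toK rep_fromK.
Qed.

End Representations.

(** The functor [K] is a parameter, with its own action on morphisms, so that
    an [induced_functor] can be compared with functors obtained otherwise, such
    as the composite in [untwist]. *)
Record Dualisation (C : MonoidalCategory) (d : C) (K : Functor (op C) C) := {
  dual_to : forall x y : C, (x ⊗ y ~> d) -> (y ~> K x);
  dual_from : forall x y : C, (y ~> K x) -> (x ⊗ y ~> d);
  dual_toK : forall x y, cancel (@dual_to x y) (@dual_from x y);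
  dual_fromK : forall x y, cancel (@dual_from x y) (@dual_to x y);
  dual_toNr : forall (x y y' : C) (h : y' ~> y) (g : x ⊗ y ~> d),
    dual_to (g ∘ (idm x ⊗₁ h)) = dual_to g ∘ h;
  dual_toNl : forall (x x' y : C) (f : x ~> x') (g : x' ⊗ y ~> d),
    dual_to (g ∘ (f ⊗₁ idm y)) = @fmap (op C) C K x' x f ∘ dual_to g }.

Section Dualisations.

Variables (C : MonoidalCategory) (d : C).

Program Definition dual_rep (K : Functor (op C) C) (s : Dualisation d K)
  (x : C) : Representation (ltensor x) d :=
  {| rep_ob := K x; rep_to := @dual_to _ _ _ s x;
     rep_from := @dual_from _ _ _ s x |}.
Next Obligation. by move=> *; exact: dual_toK. Qed.
Next Obligation. by move=> *; exact: dual_fromK. Qed.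
Next Obligation. by move=> *; exact: dual_toNr. Qed.

Program Definition induced_dualisation
  (r : forall x : C, Representation (ltensor x) d) :
  Dualisation d (induced_functor r) :=
  {| dual_to := fun x y => @rep_to _ _ _ _ (r x) y;
     dual_from := fun x y => @rep_from _ _ _ _ (r x) y |}.
Next Obligation. by move=> *; exact: rep_toK. Qed.
Next Obligation. by move=> *; exact: rep_fromK. Qed.
Next Obligation. by move=> *; exact: rep_toN. Qed.
Next Obligation. by move=> *; exact: ind_mapN. Qed.

(** Yoneda: the comparison of representing objects is natural because both
    families of bijections are. *)
Program Definition dualisation_unique (K K' : Functor (op C) C)
  (s : Dualisation d K) (t : Dualisation d K') : NatIso K K' :=
  {| nat_iso := fun x : op C => rep_unique (dual_rep s x) (dual_rep t x) |}.
Next Obligation.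
move=> K K' s t x' x f /=.
rewrite -dual_toNl -dual_toNr; congr dual_to.
apply: (can_inj (@dual_toK _ _ _ s _ _)).
by rewrite dual_toNr dual_toNl !dual_fromK comp1m compm1.
Qed.

End Dualisations.

(** * Invertible objects *)

Section Invertible.

Variable C : MonoidalCategory.
Local Notation "1" := (unit_ob C) : cat_scope.

Lemma assocN_inv (x x' y y' z z' : C)
  (f : x ~> x') (g : y ~> y') (h : z ~> z') :
  iso_inv (assoc x' y' z') ∘ (f ⊗₁ (g ⊗₁ h)) =
  (f ⊗₁ g ⊗₁ h) ∘ iso_inv (assoc x y z).
Proof.
rewrite -[f ⊗₁ (g ⊗₁ h)]compm1 -(iso_homK (assoc x y z)).
by rewrite [_ ∘ (_ ∘ iso_inv _)]compmA -assocN -compmA iso_invKl.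
Qed.

(** An object with a left and a right inverse has its right inverse as a
    two-sided one: b ≅ (a ⊗ d) ⊗ b ≅ a ⊗ (d ⊗ b) ≅ a, so b ⊗ d ≅ a ⊗ d. *)
Definition right_inverse_left (a b d : C) (u : Iso (a ⊗ d) 1)
  (v : Iso (d ⊗ b) 1) : Iso (b ⊗ d) 1 :=
  let ba : Iso b a :=
    iso_trans (iso_sym (lunit b))
      (iso_trans (iso_map (rtensor b) (iso_sym u))
        (iso_trans (assoc a d b)
          (iso_trans (iso_map (ltensor a) v) (runit a)))) in
  iso_trans (iso_map (rtensor d) ba) u.

Program Definition rtensor_inverse (d b : C) (v : Iso (d ⊗ b) 1) :
  NatIso (compF (rtensor b) (rtensor d)) (idF C) :=
  {| nat_iso := fun x =>
       iso_trans (assoc x d b) (iso_trans (iso_map (ltensor x) v) (runit x)) |}.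
Next Obligation.
move=> d b v x y f /=.
rewrite -compmA assocN tensorm1 !compmA; congr (_ ∘ _).
rewrite -compmA -tensormM comp1m compm1 -runitN -compmA -tensormM.
by rewrite comp1m compm1.
Qed.

Lemma rtensor_equivalence (d b : C) (v : Iso (d ⊗ b) 1) (w : Iso (b ⊗ d) 1) :
  is_equivalence (rtensor d).
Proof.
by exists (rtensor b); split; constructor; apply: rtensor_inverse.
Qed.

End Invertible.

(** * Dualising objects *)

Section DualisingObject.

Variables (C : MonoidalCategory) (d : C) (K : Functor (op C) C).
Variable s : Dualisation d K.
Local Notation "1" := (unit_ob C) : cat_scope.

(** Removing the twist by an invertible [d]:
    C(x ⊗ y, 1) ≅ C((x ⊗ y) ⊗ d, d) ≅ C(x ⊗ (y ⊗ d), d)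
    ≅ C(y ⊗ d, K x) ≅ C(y, K x ⊗ b). *)
Section Untwist.

Variables (b : C) (v : Iso (d ⊗ b) 1) (w : Iso (b ⊗ d) 1).
Let eta := rtensor_inverse v.
Let eps := rtensor_inverse w.
Let adj := equivalence_adjunction eta eps.

Program Definition untwist : Dualisation 1 (compF (rtensor b) K) :=
  {| dual_to := fun x y f =>
       @adj_to _ _ _ _ adj y (K x) (dual_to s
         (iso_hom (lunit d) ∘ (f ⊗₁ idm d) ∘ iso_inv (assoc x y d)));
     dual_from := fun x y g =>
       @unmap C C (rtensor d) (rtensor b) eta (x ⊗ y) 1
         (iso_inv (lunit d) ∘ dual_from s (@adj_from _ _ _ _ adj y (K x) g)
            ∘ iso_hom (assoc x y d)) |}.
Next Obligation.
move=> x y f; rewrite adj_toK dual_toK -!compmA iso_invK compm1 iso_invKl.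
exact: (fmapK eta).
Qed.
Next Obligation.
move=> x y g.
have fromE (h : (x ⊗ y) ⊗ d ~> 1 ⊗ d) : unmap eta h ⊗₁ idm d = h.
  exact: (unmapK eta eps).
rewrite fromE -!compmA iso_homKl iso_homK compm1 dual_fromK.
exact: (adj_fromK adj).
Qed.
Next Obligation.
move=> x y y' h g.
have -> : (g ∘ (idm x ⊗₁ h)) ⊗₁ idm d = (g ⊗₁ idm d) ∘ ((idm x ⊗₁ h) ⊗₁ idm d).
  by rewrite -tensormM comp1m.
(* [adj_toN] moves morphisms on both sides at once, hence the identities. *)
rewrite compmA -compmA -assocN_inv compmA dual_toNr -[dual_to _ _]comp1m.
by rewrite (adj_toN adj h) fmap1 !comp1m.
Qed.
Next Obligation.
move=> x x' y f g.
have -> : (g ∘ (f ⊗₁ idm y)) ⊗₁ idm d = (g ⊗₁ idm d) ∘ ((f ⊗₁ idm y) ⊗₁ idm d).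
  by rewrite -tensormM comp1m.
rewrite compmA -compmA -assocN_inv compmA tensorm1 dual_toNl.
rewrite -[_ ∘ dual_to _ _]compm1 -[idm (y ⊗ d)](fmap1 (rtensor d) y).
by rewrite (adj_toN adj) compm1.
Qed.

End Untwist.

(** The presheaf C(- ⊗ K 1, d) ≅ C(K 1, K -) is C(-, 1) when [K] is fully
    faithful. *)
Program Definition unit_rep (E : Functor C (op C))
  (eta : NatIso (compF E K) (idF (op C))) (eps : NatIso (compF K E) (idF C)) :
  Representation (rtensor (K 1)) d :=
  {| rep_ob := 1;
     rep_to := fun x f => @unmap _ _ K E eta 1 x (dual_to s f);
     rep_from := fun x g => dual_from s (@fmap _ _ K 1 x g) |}.
Next Obligation. by move=> E eta eps x f; rewrite (unmapK eta eps) dual_toK. Qed.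
Next Obligation. by move=> E eta eps x g; rewrite dual_fromK fmapK. Qed.
Next Obligation.
by move=> E eta eps x x' h f; rewrite /= dual_toNl; exact: (unmapM eta).
Qed.

End DualisingObject.

(** * The three characterisations *)

(** Whether [d] is dualising does not depend on the choice of representing
    objects. *)
Lemma induced_functor_equivalence (C : MonoidalCategory) (d : C)
  (K : Functor (op C) C) (s : Dualisation d K)
  (r : forall x : C, Representation (ltensor x) d) :
  is_equivalence K -> is_equivalence (induced_functor r).
Proof.
by apply: is_equivalence_iso; apply: dualisation_unique s (induced_dualisation r).
Qed.

(** A dualising object is invertible, so its dualising functor can be
    untwisted into one for the unit. *)
Lemma right_GV_unit (C : MonoidalCategory) (T : TensorRepresentable C) (d : C) :
  right_GV d -> r_category C.
Proof.
move=> [D eqD]; have [E [[eta] [eps]]] := eqD.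
set K := induced_functor D in eqD E eta eps.
pose s : Dualisation d K := induced_dualisation D.
pose e : C := E (unit_ob C).
pose k : C := K (unit_ob C).
(* R e ⊗ d and K e ≅ 1 both represent C(e ⊗ -, d). *)
have u : Iso (Rob T e ⊗ d) (unit_ob C).
  apply: iso_trans (eps (unit_ob C)).
  exact: rep_unique (adj_representation (Rob_adj T e) d) (dual_rep s e).
(* d ⊗ L k and 1 both represent C(- ⊗ k, d). *)
have v : Iso (d ⊗ Lob T k) (unit_ob C).
  exact: rep_unique (adj_representation (Lob_adj T k) d) (unit_rep s eta eps).
have w := right_inverse_left u v.
exists (fun x => adj_representation (Rob_adj T x) (unit_ob C)).
apply: (induced_functor_equivalence (untwist s v w)).
exact: is_equivalence_comp (rtensor_equivalence w v) eqD.
Qed.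

Theorem proposition3p15 (C : MonoidalCategory) (T : TensorRepresentable C) :
  ((exists Q : Functor C (op C),
      quasi_inverse (right_dualising (tensor_right_closed T)) Q)
   <-> r_category C) /\
  (r_category C <-> exists d : C, right_GV d).
Proof.
split; split.
- by move=> eqR; exists (fun x => adj_representation (Rob_adj T x) (unit_ob C)).
- by move=> [D]; apply: induced_functor_equivalence (induced_dualisation D) _.
- by exists (unit_ob C).
- by move=> [d]; apply: right_GV_unit.
Qed.
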